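(* For a positive integer $n$, let $P(n)$ denote the assertion: for every compact set $A \subset \mathbb{R}^n$, the sequence $\left(\Delta(A(k))\right)_{k \ge 1}$ is non-increasing in $k$ (equivalently, the sequence $\left(\mathrm{Vol}_n(A(k))\right)_{k\ge 1}$ is non-decreasing). Then $P(n)$ is false for every $n \ge 12$ (that is, for every integer $n\ge 12$ there exist a compact set $A\subset\mathbb{R}^n$ and an integer $k\ge 1$ such that $\mathrm{Vol}_n(A(k+1)) < \mathrm{Vol}_n(A(k))$), and $P(1)$ is true.
   Context: For a compact set $A\subset\mathbb{R}^n$ and a positive integer $k$, the Minkowski average is $$A(k) = \left\{\frac{a_1+\cdots+a_k}{k} : a_1,\ldots,a_k\in A\right\}.$$ $\mathrm{Vol}_n$ denotes Lebesgue measure on $\mathbb{R}^n$ and $\mathrm{conv}(A)$ is the convex hull of $A$. The volume deficit of a compact set $A\subset\mathbb{R}^n$ is $$\Delta(A) = \mathrm{Vol}_n(\mathrm{conv}(A)\setminus A) = \mathrm{Vol}_n(\mathrm{conv}(A)) - \mathrm{Vol}_n(A).$$ *)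

(* Defs.v *)
From HB Require Import structures.
From mathcomp Require Import all_boot all_order all_algebra.
From mathcomp Require Import all_classical all_reals all_analysis.

Set Implicit Arguments.
Unset Strict Implicit.
Unset Printing Implicit Defensive.

Import Order.TTheory GRing.Theory Num.Theory.
Import numFieldNormedType.Exports.

Local Open Scope classical_set_scope.
Local Open Scope ring_scope.

Lemma sigma_finite_product (d1 d2 : measure_display) (T1 : measurableType d1)
    (T2 : measurableType d2) (R : realType)
    (m1 : {sigma_finite_measure set T1 -> \bar R})
    (m2 : {sigma_finite_measure set T2 -> \bar R}) :
  sigma_finite [set: T1 * T2] (m1 \x m2)%E.
Proof.
have /sigma_finiteP[F [TF ndF Foo]] := sigma_finiteT m1.
have /sigma_finiteP[G [TG ndG Goo]] := sigma_finiteT m2.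
exists (fun n => F n `*` G n).
  rewrite -setXTT TF TG predeqE => -[x y]; split.
    move=> [/= [n _ Fnx] [k _ Gky]]; exists (maxn n k) => //; split.
    - by move: x Fnx; exact/subsetPset/ndF/leq_maxl.
    - by move: y Gky; exact/subsetPset/ndG/leq_maxr.
  by move=> [n _ []/= ? ?]; split; exists n.
move=> k; have [mF Fk] := Foo k; have [mG Gk] := Goo k.
split; first exact: measurableX.
by rewrite product_measure1E// lte_mul_pinfty// ge0_fin_numE.
Qed.

Section lebesgue_tuple.
Variable R : realType.
Local Notation RT := (measurableTypeR R).

Definition tuple_cons (n : nat) (p : RT * n.-tuple RT) : n.+1.-tuple RT :=
  [tuple of p.1 :: p.2].

Definition tuple_uncons (n : nat) (t : n.+1.-tuple RT) : RT * n.-tuple RT :=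
  (thead t, [tuple of behead t]).

Lemma tuple_consK (n : nat) : cancel (@tuple_cons n) (@tuple_uncons n).
Proof.
case=> x t; rewrite /tuple_uncons /tuple_cons /= theadE; congr pair.
exact/val_inj.
Qed.

Lemma measurable_tuple_cons (n : nat) :
  measurable_fun [set: RT * n.-tuple RT] (@tuple_cons n).
Proof. by apply: measurable_cons. Qed.

Lemma measurable_tuple_uncons (n : nat) :
  measurable_fun [set: n.+1.-tuple RT] (@tuple_uncons n).
Proof.
apply/measurable_fun_pair => /=.
- exact: measurable_tnth.
- exact: measurable_behead.
Qed.

Section step.
Variables (n : nat) (mu : {sigma_finite_measure set (n.-tuple RT) -> \bar R}).

Definition lebesgue_cons : set (n.+1.-tuple RT) -> \bar R :=
  pushforward (lebesgue_measure \x mu)%E (@tuple_cons n).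

Let lebesgue_cons0 : lebesgue_cons set0 = 0%E.
Proof. by rewrite /lebesgue_cons /pushforward preimage_set0 measure0. Qed.

Let preimage_measurable (A : set (n.+1.-tuple RT)) :
  measurable A -> measurable (@tuple_cons n @^-1` A).
Proof.
by move=> mA; rewrite -[X in measurable X]setTI; exact: measurable_tuple_cons.
Qed.

Let lebesgue_cons_ge0 A : (0 <= lebesgue_cons A)%E.
Proof. exact: (measure_ge0 (lebesgue_measure \x mu)%E). Qed.

Let lebesgue_cons_sigma_additive : semi_sigma_additive lebesgue_cons.
Proof.
move=> F mF tF mUF; rewrite /lebesgue_cons /pushforward preimage_bigcup.
apply: measure_semi_sigma_additive.
- by move=> i; exact: preimage_measurable.
- apply/trivIsetP => /= i j _ _ ij; rewrite -preimage_setI.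
  by move/trivIsetP : tF => /(_ _ _ _ _ ij) ->//; rewrite preimage_set0.
- by rewrite -preimage_bigcup; exact: preimage_measurable.
Qed.

HB.instance Definition _ := isMeasure.Build _ _ _ lebesgue_cons
  lebesgue_cons0 lebesgue_cons_ge0 lebesgue_cons_sigma_additive.

Let lebesgue_cons_sigma_finite : sigma_finite [set: n.+1.-tuple RT] lebesgue_cons.
Proof.
have [F FT Foo] := sigma_finite_product lebesgue_measure mu.
exists (fun i => @tuple_uncons n @^-1` F i).
  by rewrite -preimage_bigcup -FT preimage_setT.
move=> i; have [mF Fi] := Foo i; split.
  by rewrite -[X in measurable X]setTI; exact: measurable_tuple_uncons.
rewrite /lebesgue_cons /pushforward.
suff -> : @tuple_cons n @^-1` (@tuple_uncons n @^-1` F i) = F i by [].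
by apply/seteqP; split=> p /=; rewrite tuple_consK.
Qed.

HB.instance Definition _ := Measure_isSigmaFinite.Build _ _ _
  lebesgue_cons lebesgue_cons_sigma_finite.

End step.

(* The product of n copies of the Lebesgue measure on the line. *)
Fixpoint lebesgue_tuple (n : nat) :
    {sigma_finite_measure set (n.-tuple RT) -> \bar R} :=
  match n with
  | 0 => [the {sigma_finite_measure set (0.-tuple RT) -> \bar R} of
            dirac ([tuple] : 0.-tuple RT)]
  | n'.+1 => [the {sigma_finite_measure set (n'.+1.-tuple RT) -> \bar R} of
               lebesgue_cons (lebesgue_tuple n')]
  end.

Lemma lebesgue_tuple_box (n : nat) (B : 'I_n -> set RT) :
  (forall i, measurable (B i)) ->
  lebesgue_tuple n [set t | forall i, B i (tnth t i)] =
  (\prod_(i < n) lebesgue_measure (B i))%E.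
Proof.
elim: n B => [|n IHn] B mB.
  rewrite big_ord0 /= (_ : [set _ | _] = setT) ?diracT//.
  by apply/seteqP; split=> t //= _ [].
rewrite big_ord_recl -(IHn (fun i => B (lift ord0 i)))//=.
rewrite /lebesgue_cons /pushforward -product_measure1E//.
  congr product_measure1; apply/seteqP; split=> -[x t] /=.
    move=> Bxt; split; first exact: (Bxt ord0).
    by move=> i; move: (Bxt (lift ord0 i)); rewrite tnthS.
  move=> [Bx Bt] i; case: (unliftP ord0 i) => [j|] ->; last by [].
  by rewrite tnthS; exact: Bt.
rewrite (_ : [set _ | _] =
    \big[setI/setT]_(i < n) (fun t => tnth t i) @^-1` (B (lift ord0 i))).
  apply: bigsetI_measurable => i _; rewrite -[X in measurable X]setTI.
  exact: measurable_tnth.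
apply/seteqP; split=> t /=.
  by move=> Bt; elim/big_ind: _ => //= X Y ? ?; split.
by move=> + i; rewrite (bigD1 i)//= => -[].
Qed.

End lebesgue_tuple.

Section volume_deficit.
Variables (R : realType) (n : nat).
Implicit Types A : set 'rV[R]_n.

(* Lebesgue measure of subsets of R^n, transported from n-tuples; meaningful
   for Borel sets. *)
Definition Vol A : \bar R :=
  lebesgue_tuple R n [set t | A (\row_i tnth t i)].

Definition conv_hull A : set 'rV[R]_n := smallest (@convex_set R 'rV[R]_n) A.

Definition minkowski_average A (k : nat) : set 'rV[R]_n :=
  [set k%:R^-1 *: \sum_(i < k) a i | a in [set a : 'I_k -> 'rV[R]_n |
                                            forall i, A (a i)]].

Definition volume_deficit A : \bar R := Vol (conv_hull A `\` A).

End volume_deficit.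

(* The assertion P(n); index k of the sequence stands for A(k + 1), so that it
   starts at A(1). *)
Definition deficit_monotone (R : realType) (n : nat) : Prop :=
  forall A : set 'rV[R]_n, compact A ->
    nonincreasing_seq (fun k => volume_deficit (minkowski_average A k.+1)).

(* Main.v *)
Require Import Defs.
From HB Require Import structures.
From mathcomp Require Import all_boot all_order all_algebra.
From mathcomp Require Import all_classical all_reals all_analysis.
From mathcomp Require Import measurable_realfun ring lra.

Set Implicit Arguments.
Unset Strict Implicit.
Unset Printing Implicit Defensive.

Import Order.TTheory GRing.Theory Num.Theory.
Import numFieldNormedType.Exports.

Local Open Scope classical_set_scope.
Local Open Scope ring_scope.

(** Write [A(k)] for the Minkowski average of [k] copies of [A].

    All the averages of a compact set [A] have the same convex hull as [A]
    (each contains [A] and lies in its hull), so the deficit of [A(k)] is the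
    constant [Vol (conv A)] minus [Vol (A(k))]: this is the equivalence of the
    two monotonicity statements ([nonincreasing_deficit_Vol]).  The subtraction
    needs [conv A] to be Borel of finite volume; it is a countable increasing
    union of compact sets, obtained by repeatedly adding all segments
    ([conv_hullE]).

    In dimension [n >= 12], take the union [A] of two faces of the unit cube,
    one where the coordinates [0..5] vanish and one where the coordinates
    [6..11] vanish ([crossed_cubes]).  Choosing one point in each face shows
    that [A(2)] contains a brick of volume [2 ^ -12].  A sum of three points,
    [p] of them in the second face, lies in the brick with sides [p/3] along
    the coordinates [0..5] and [(3 - p)/3] along the coordinates [6..11], so
    [Vol (A(3))] is at most the sum over [p = 0..3] of [(p (3 - p) / 9) ^ 6],
    that is, [128 / 3 ^ 12].  Since [128 * 2 ^ 12 = 524288] is less than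
    [3 ^ 12 = 531441], the volume drops ([Vol_crossed_cubes_lt]).

    In dimension 1, let [m] and [M] be the extreme points of [A], [T = A(k)] and
    [S = A(k+1)].  Two contractions of ratio [k / (k+1)] send [T] into [S]:
    averaging with [m], and averaging with [M].  Cut [[m, M]] into [k] equal
    parts by [t_0 <= ... <= t_k].  The first contraction applied to the part of
    [T] left of [t_(i+1)] and the second one applied to the part of [T] right
    of [t_i] have images on the two sides of a single point, so their measures
    add up: [|S| >= k / (k+1) * (|T| + |T between t_i and t_(i+1)|)].  Summing
    over [i] gives [k |S| >= k / (k+1) * (k |T| + |T|) = k |T|]
    ([average_step_lebesgue_measure]). *)

(** * Borel subsets of the space of row vectors *)

Section borel.
Variable R : realType.
Local Notation RT := (measurableTypeR R).

(** The volume is defined on tuples, whose sigma-algebra is the product one, so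
    measurability of a set of row vectors is read off from this set of tuples. *)
Definition coordinates n (A : set 'rV[R]_n) : set (n.-tuple RT) :=
  [set t | A (\row_i tnth t i)].

Definition box n (B : 'I_n -> set R) : set 'rV[R]_n :=
  [set v | forall i, B i (v ord0 i)].

Lemma coordinates_box n (B : 'I_n -> set R) :
  coordinates (box B) = [set t | forall i, B i (tnth t i)].
Proof.
by apply/seteqP; split => t /= h i; move: (h i); rewrite mxE.
Qed.

Lemma measurable_box n (B : 'I_n -> set R) :
  (forall i, measurable (B i : set RT)) -> measurable (coordinates (box B)).
Proof.
move=> mB; rewrite coordinates_box.
rewrite (_ : [set _ | _] =
    \big[setI/setT]_(i < n) (fun t : n.-tuple RT => tnth t i) @^-1` (B i)).
  apply: bigsetI_measurable => i _; rewrite -[X in measurable X]setTI.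
  exact: measurable_tnth.
apply/seteqP; split => t /=.
  by move=> Bt; elim/big_ind: _ => //= X Y ? ?; split.
by move=> + i; rewrite (bigD1 i)//= => -[].
Qed.

Lemma Vol_box n (B : 'I_n -> set R) :
  (forall i, measurable (B i : set RT)) ->
  Vol (box B) = (\prod_(i < n) lebesgue_measure (B i : set RT))%E.
Proof. by move=> mB; rewrite -lebesgue_tuple_box// -coordinates_box. Qed.

(** The balls of the sup norm are cubes, so that countably many open cubes, with
    rational centre and radius [1 / m], generate the topology. *)
Lemma open_bigcup_rational_balls n (U : set 'rV[R]_n) : open U ->
  U = \bigcup_(i : 'rV[rat]_n * nat)
        [set v | ball (map_mx ratr i.1 : 'rV[R]_n) i.2.+1%:R^-1 `<=` U /\
                 ball (map_mx ratr i.1 : 'rV[R]_n) i.2.+1%:R^-1 v].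
Proof.
move=> oU; apply/seteqP; split => [v Uv|v [i _ [/= h1 h2]]]; last exact: h1.
have /nbhs_ballP[e/= e0 veU] : nbhs v U by exact: open_nbhs_nbhs.
have [m] : exists m : nat, m.+1%:R^-1 < e / 2 :> R.
  exists (Num.truncn (e / 2)^-1).
  rewrite invf_plt ?posrE ?divr_gt0//.
  exact: truncnS_gt.
set r := m.+1%:R^-1 => re.
have r0 : 0 < r by rewrite invr_gt0.
have /choice[q qv] : forall j : 'I_n, exists q : rat, `|ratr q - v ord0 j| < r.
  move=> j; have [|q] := @rat_in_itvoo R (v ord0 j - r) (v ord0 j + r).
    by rewrite ltrD2l gtrN.
  rewrite in_itv/= => /andP[h1 h2]; exists q.
  by rewrite ltr_norml ltrBrDr addrC h1/= ltrBlDl.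
exists (\row_j q j, m) => //=; rewrite -/r.
have bv : ball (map_mx ratr (\row_j q j) : 'rV[R]_n) r v.
  by split => // i j; rewrite !mxE ord1; exact: qv.
split => // w bw; apply: veU.
apply: (@le_ball _ _ _ (r + r)); first by rewrite (splitr e) lerD// ltW.
by apply: ball_triangle bw; exact: ball_sym.
Qed.

Lemma open_measurable_coordinates n (U : set 'rV[R]_n) :
  open U -> measurable (coordinates U).
Proof.
move=> /open_bigcup_rational_balls ->.
rewrite [X in measurable X](_ : _ = \bigcup_(i : 'rV[rat]_n * nat)
  coordinates [set v | ball (map_mx ratr i.1 : 'rV[R]_n) i.2.+1%:R^-1 `<=` U /\
                 ball (map_mx ratr i.1 : 'rV[R]_n) i.2.+1%:R^-1 v]); last first.
  by apply/seteqP; split => t [i _ h]; exists i.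
apply: countable_bigcupT_measurable => // -[q m]/=.
have [qU|qU] := pselect (ball (map_mx ratr q : 'rV[R]_n) m.+1%:R^-1 `<=` U);
    last first.
  by rewrite [X in measurable X](_ : _ = set0)// -subset0 => t [].
rewrite [X in measurable X](_ : _ =
    coordinates (box (fun j => ball (ratr (q ord0 j) : R) m.+1%:R^-1))).
  by apply: measurable_box => j; apply: open_measurable; exact: ball_open.
apply/seteqP; split => t /=.
  by move=> [_ [_ h]] j; have := h ord0 j; rewrite !mxE.
move=> h; split => //; split; first by rewrite invr_gt0.
by move=> i j; move: (h j); rewrite (ord1 i) !mxE.
Qed.

Lemma closed_measurable_coordinates n (A : set 'rV[R]_n) :
  closed A -> measurable (coordinates A).
Proof.
move=> cA; rewrite -[A]setCK; apply: measurableC.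
by apply: open_measurable_coordinates; exact: closed_openC.
Qed.

Lemma compact_measurable_coordinates n (A : set 'rV[R]_n) :
  compact A -> measurable (coordinates A).
Proof.
move=> cA; apply: closed_measurable_coordinates.
by apply: compact_closed cA; exact: norm_hausdorff.
Qed.

Lemma Vol_le n (A B : set 'rV[R]_n) :
  measurable (coordinates A) -> measurable (coordinates B) ->
  A `<=` B -> (Vol A <= Vol B)%E.
Proof.
by move=> mA mB AB; apply: le_measure; rewrite ?inE// => t; exact: AB.
Qed.

End borel.

(** * Convex hulls and Minkowski averages of compact sets *)

Section convexity.
Variable R : realType.
Local Notation RT := (measurableTypeR R).

(** The average is the image of the product [A ^ k], compact by Tychonoff. *)
Lemma compact_minkowski_average n (A : set 'rV[R]_n) k :
  compact A -> compact (minkowski_average A k).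
Proof.
move=> cA.
have cAk : compact ([set a | forall i, A (a i)] :
    set (prod_topology (fun _ : 'I_k => 'rV[R]_n : topologicalType))).
  exact: (@tychonoff _ (fun _ : 'I_k => 'rV[R]_n : topologicalType)
    (fun=> A)).
apply: (continuous_compact (f := fun a : prod_topology
  (fun _ : 'I_k => 'rV[R]_n : topologicalType) => k%:R^-1 *: \sum_(i < k) a i)) cAk.
apply: continuous_subspaceT => a.
apply: continuousZl_tmp.
apply: continuous_big => [|i _]; first exact: add_continuous.
exact: (@proj_continuous _ (fun _ : 'I_k => 'rV[R]_n : topologicalType) i).
Qed.

Lemma sub_minkowski_average n (A : set 'rV[R]_n) k :
  A `<=` minkowski_average A k.+1.
Proof.
move=> x Ax; exists (fun=> x) => //.
by rewrite sumr_const card_ord -[x *+ _]scaler_nat scalerA mulVf// scale1r.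
Qed.

(** Iterating the union of all segments reaches the convex hull in countably many
    steps, each of which preserves compactness; this spares Caratheodory's
    theorem. *)
Fixpoint segment_closure n (A : set 'rV[R]_n) m : set 'rV[R]_n :=
  if m is m'.+1 then
    [set p.1.1 *: p.1.2 + (1 - p.1.1) *: p.2 |
       p in `[0, 1]%classic `*` segment_closure A m' `*` segment_closure A m']
  else A.

Lemma compact_segment_closure n (A : set 'rV[R]_n) m :
  compact A -> compact (segment_closure A m).
Proof.
move=> cA; elim: m => [//|m ih] /=.
apply: continuous_compact; last first.
  by do 2!apply: compact_setX => //; exact: segment_compact.
apply: continuous_subspaceT => -[[t x] y].
apply: cvgD.
  apply: cvgZ; first exact: cvg_comp cvg_fst cvg_fst.
  exact: cvg_comp cvg_fst cvg_snd.
apply: cvgZ; last exact: cvg_snd.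
by apply: cvgB; [exact: cvg_cst|exact: cvg_comp cvg_fst cvg_fst].
Qed.

Lemma segment_closure_homo n (A : set 'rV[R]_n) :
  {homo segment_closure A : m p / (m <= p)%N >-> m `<=` p}.
Proof.
apply: homo_leq => [B x //|B C D|m x mx]; first exact: subset_trans.
exists ((1, x), x) => /=; last by rewrite subrr scale0r addr0 scale1r.
by split=> //; split=> //=; rewrite in_itv/= ler01 lexx.
Qed.

Lemma conv_hull_sub n (A B : set 'rV[R]_n) :
  @convex_set R 'rV[R]_n B -> A `<=` B -> conv_hull A `<=` B.
Proof. by move=> cB AB; exact: smallest_sub. Qed.

Lemma sub_conv_hull n (A : set 'rV[R]_n) : A `<=` conv_hull A.
Proof. by move=> x Ax B [_]; exact. Qed.

Lemma convex_setP n (A : set 'rV[R]_n) :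
  @convex_set R 'rV[R]_n A <->
  forall x y (t : R), A x -> A y -> 0 <= t <= 1 -> A (t *: x + (1 - t) *: y).
Proof.
split=> [cA x y t Ax Ay t01|cA x y t /[!inE] Ax Ay].
  have := cA x y (Itv01 (andP t01).1 (andP t01).2).
  by rewrite !inE; exact.
by apply: cA => //; apply/andP; split; [exact: ge0|exact: le1].
Qed.

Lemma convex_conv_hull n (A : set 'rV[R]_n) :
  @convex_set R 'rV[R]_n (conv_hull A).
Proof.
apply/convex_setP => x y t Ax Ay t01 B BA.
have /convex_setP := BA.1; apply => //; [exact: Ax|exact: Ay].
Qed.

Lemma conv_hullE n (A : set 'rV[R]_n) :
  conv_hull A = \bigcup_m segment_closure A m.
Proof.
apply/seteqP; split.
  apply: conv_hull_sub => [|x Ax]; last by exists 0%N.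
  apply/convex_setP => x y t [m _ mx] [p _ py] t01.
  exists (maxn m p).+1 => //=; exists ((t, x), y) => //=.
  by do !split => //=; [apply: segment_closure_homo mx; exact: leq_maxl|
                apply: segment_closure_homo py; exact: leq_maxr].
move=> x [m _]; elim: m x => [|m ih] x /=; first exact: sub_conv_hull.
move=> [[[t y] z] /= [[t01 my] mz] <-].
have /convex_setP := @convex_conv_hull n A.
by apply; [exact: ih|exact: ih|].
Qed.

Lemma conv_hull_measurable_coordinates n (A : set 'rV[R]_n) :
  compact A -> measurable (coordinates (conv_hull A)).
Proof.
move=> cA; rewrite conv_hullE.
rewrite [X in measurable X](_ : _ =
    \bigcup_m coordinates (segment_closure A m))//.
apply: bigcupT_measurable => m.
by apply: compact_measurable_coordinates; exact: compact_segment_closure.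
Qed.

(** The average of [k + 2] points is a convex combination of the last one, of
    weight [1 / (k + 2)], and of the average of the others. *)
Lemma convex_set_average n (B : set 'rV[R]_n) k (a : 'I_k.+1 -> 'rV[R]_n) :
  @convex_set R 'rV[R]_n B -> (forall i, B (a i)) ->
  B (k.+1%:R^-1 *: \sum_(i < k.+1) a i).
Proof.
move=> /convex_setP cB; elim: k a => [|k ih] a Ba.
  by rewrite big_ord_recr big_ord0/= add0r invr1 scale1r.
rewrite big_ord_recr/= scalerDr.
set s := \sum_(i < _) _.
have -> : k.+2%:R = k.+1%:R + 1 :> R by rewrite -natr1.
set u : R := k.+1%:R; have u0 : 0 < u by rewrite ltr0n.
have u1 : u + 1 != 0 by rewrite lt0r_neq0// ltr_wpDr.
have -> : (u + 1)^-1 *: s + (u + 1)^-1 *: a ord_max =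
    (u / (u + 1)) *: (u^-1 *: s) + (1 - u / (u + 1)) *: a ord_max.
  rewrite scalerA; congr (_ *: _ + _ *: _); clearbody u; field => //.
  by rewrite u1 lt0r_neq0.
apply: cB => //; first by apply: ih => i; exact: Ba.
by rewrite divr_ge0 ?ler_pdivrMr//; lra.
Qed.

Lemma conv_hull_minkowski_average n (A : set 'rV[R]_n) k :
  conv_hull (minkowski_average A k.+1) = conv_hull A.
Proof.
apply/seteqP; split; apply: conv_hull_sub; try exact: convex_conv_hull.
  move=> _ [a Aa <-]; apply: convex_set_average; first exact: convex_conv_hull.
  by move=> i; apply: sub_conv_hull; exact: Aa.
by apply: subset_trans (@sub_conv_hull _ _); exact: sub_minkowski_average.
Qed.

(** A cube is convex, so a cube that contains [A] contains its hull. *)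
Lemma Vol_conv_hull_fin_num n (A : set 'rV[R]_n) :
  compact A -> Vol (conv_hull A) \is a fin_num.
Proof.
move=> cA; have [M [Mr AM]] := compact_bounded cA.
pose b : R := M + 1.
pose B : 'I_n -> set R := fun=> `[- b, b]%classic.
have hAB : conv_hull A `<=` box B.
  apply: conv_hull_sub.
    apply/convex_setP => x y t xB yB /andP[t0 t1] i.
    move: (xB i) (yB i); rewrite /B/= !in_itv/= !mxE => /andP[x1 x2] /andP[y1 y2].
    by nra.
  move=> x /(AM b) xb i; rewrite /B/= in_itv/= -ler_norml.
  apply: le_trans (xb _); last by rewrite ltrDl.
  rewrite [leRHS]/Num.norm /= mx_normrE.
  by apply: (le_bigmax _ (fun ij : 'I_1 * 'I_n => `|x ij.1 ij.2|) (ord0, i)).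
have mB i : measurable (B i : set RT) by exact: measurable_itv.
have Bfin : Vol (box B) \is a fin_num.
  rewrite Vol_box//; elim/big_ind: _ => // [x y|i _]; first exact: fin_numM.
  by rewrite /B lebesgue_measure_itv/=; case: ifP.
move: Bfin; rewrite !ge0_fin_numE; try exact: measure_ge0.
apply: le_lt_trans; apply: Vol_le => //; first exact: conv_hull_measurable_coordinates.
exact: measurable_box.
Qed.

Lemma Vol_compact_fin_num n (A : set 'rV[R]_n) :
  compact A -> Vol A \is a fin_num.
Proof.
move=> cA; rewrite ge0_fin_numE; last exact: measure_ge0.
apply: (@le_lt_trans _ _ (Vol (conv_hull A))).
  apply: Vol_le; last exact: sub_conv_hull.
    exact: compact_measurable_coordinates.
  exact: conv_hull_measurable_coordinates.
by rewrite -ge0_fin_numE ?Vol_conv_hull_fin_num//; exact: measure_ge0.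
Qed.

Lemma volume_deficitE n (A : set 'rV[R]_n) : compact A ->
  volume_deficit A = (Vol (conv_hull A) - Vol A)%E.
Proof.
move=> cA; have mA := compact_measurable_coordinates cA.
have mH := conv_hull_measurable_coordinates cA.
rewrite -[in X in (_ - X)%E](setIidr (@sub_conv_hull _ A)).
apply: (@measureD _ _ _ (lebesgue_tuple R n) _ _ mH mA).
rewrite -ge0_fin_numE; last exact: measure_ge0.
exact: Vol_conv_hull_fin_num.
Qed.

Lemma nonincreasing_deficit_Vol n (A : set 'rV[R]_n) : compact A ->
  nonincreasing_seq (fun k => volume_deficit (minkowski_average A k.+1)) <->
  nondecreasing_seq (fun k => Vol (minkowski_average A k.+1)).
Proof.
move=> cA.
have cAk k : compact (minkowski_average A k) by exact: compact_minkowski_average.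
have E k p : (volume_deficit (minkowski_average A k.+1) <=
              volume_deficit (minkowski_average A p.+1))%E =
             (Vol (minkowski_average A p.+1) <=
              Vol (minkowski_average A k.+1))%E.
  rewrite !volume_deficitE// !conv_hull_minkowski_average.
  rewrite -(fineK (Vol_conv_hull_fin_num cA)).
  rewrite -(fineK (Vol_compact_fin_num (cAk k.+1))).
  rewrite -(fineK (Vol_compact_fin_num (cAk p.+1))).
  by rewrite -!EFinB !lee_fin lerD2l lerN2.
by split=> h k p kp; have := h k p kp; rewrite ?E.
Qed.

End convexity.

(** * Two crossed cubes *)

Section crossed_cubes.
Variables (R : realType) (d n : nat).

(** Sides of a brick: [p / k] along the first [d] coordinates, [q / k] along the
    next [d], [1] along the remaining ones.  Degenerate bricks ([p = 0] or [q = 0],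
    [k = 1]) are the faces that form [crossed_cubes]; a point of
    [crossed_cubes(k)] with [p] summands in one face and [q] in the other is in
    [brick k p q]. *)
Definition side (k p q j : nat) : R :=
  if (j < d)%N then p%:R / k%:R else if (j < d + d)%N then q%:R / k%:R else 1.

Definition brick (k p q : nat) : set 'rV[R]_n :=
  box (fun j : 'I_n => `[0, side k p q j]%classic).

Definition crossed_cubes : set 'rV[R]_n := brick 1 0 1 `|` brick 1 1 0.

Lemma brickP k p q (v : 'rV[R]_n) :
  brick k p q v <-> forall j, 0 <= v ord0 j <= side k p q j.
Proof. by split=> h j; move: (h j); rewrite /= in_itv. Qed.

Lemma side_ge0 k p q j : 0 <= side k p q j.
Proof. by rewrite /side; do 2!case: ifP => _ //; rewrite divr_ge0. Qed.

Lemma compact_brick k p q : compact (brick k p q).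
Proof.
apply: (@rV_compact R n (fun j => `[0, side k p q j]%classic)) => j.
exact: segment_compact.
Qed.

Lemma compact_crossed_cubes : compact crossed_cubes.
Proof. by apply: compactU; exact: compact_brick. Qed.

Lemma Vol_brick k p q : (d + d <= n)%N ->
  Vol (brick k p q) = (((p%:R / k%:R) * (q%:R / k%:R)) ^+ d)%:E.
Proof.
move=> dn; rewrite Vol_box//.
rewrite (eq_bigr (fun j : 'I_n => (side k p q j)%:E)) => [|j _]; last first.
  rewrite lebesgue_measure_itv/= lte_fin sube0.
  by have := side_ge0 k p q j; rewrite le_eqVlt; case: eqVneq => [<-|_ /= ->//];
    rewrite ltxx.
rewrite prodEFin; congr EFin.
rewrite -(big_mkord xpredT (side k p q)).
(* Split the product at the two places where the side changes. *)
rewrite (big_cat_nat (n := d + d)%N)//= (big_cat_nat (n := d)%N) ?leq_addr//=.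
rewrite (eq_big_nat _ _ (F2 := fun=> p%:R / k%:R)) => [|j /andP[_ jd]]; last first.
  by rewrite /side jd.
rewrite [X in _ * X * _](eq_big_nat _ _ (F2 := fun=> q%:R / k%:R))
    => [|j /andP[dj jd]]; last first.
  by rewrite /side ltnNge dj/= jd.
rewrite [X in _ * X](eq_big_nat _ _ (F2 := fun=> 1)) => [|j /andP[dj jd]]; last first.
  by rewrite /side !ltnNge dj/= (leq_trans (leq_addr _ _) dj).
by rewrite !prodr_const_nat expr1n mulr1 subn0 addnK -exprMn.
Qed.

(** The brick that contains an average depends only on the number [p] of its
    summands that are chosen in the face [brick 1 1 0], since each summand
    contributes at most [1 / k] to every side of its face. *)
Lemma minkowski_average_crossed_cubes_sub k : (0 < k)%N ->
  minkowski_average crossed_cubes k `<=`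
  [set v | exists p : 'I_k.+1, brick k p (k - p) v].
Proof.
move=> k0 _ [a Aa <-].
have /choice[b ab] : forall i, exists b : bool, brick 1 b (~~ b) (a i).
  by move=> i; case: (Aa i) => h; [exists false|exists true].
(* [b i] tells whether [a i] was chosen in the face [brick 1 1 0]. *)
have pk : (\sum_(i < k) b i < k.+1)%N.
  by rewrite ltnS -[leqRHS]card_ord -sum1_card leq_sum// => i _; case: (b i).
exists (Ordinal pk); apply/brickP => j; rewrite mxE summxE.
have k0' : (k%:R : R) > 0 by rewrite ltr0n.
apply/andP; split.
  rewrite mulr_ge0// ?invr_ge0// sumr_ge0// => i _.
  by have /brickP/(_ j)/andP[] := ab i.
rewrite mulrC ler_pdivrMr//.
have -> : side k (\sum_(i < k) b i) (k - \sum_(i < k) b i) j * k%:R =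
    \sum_(i < k) side 1 (b i) (~~ b i) j.
  rewrite /side; case: ifP => _.
    rewrite divfK ?gt_eqF// natr_sum; apply: eq_bigr => i _.
    by rewrite invr1 mulr1.
  case: ifP => _; last by rewrite sumr_const card_ord mul1r.
  rewrite divfK ?gt_eqF// natrB// natr_sum.
  rewrite -[X in X%:R - _]card_ord -sumr_const -sumrB.
  by apply: eq_bigr => i _; rewrite invr1 mulr1; case: (b i); rewrite ?subrr ?subr0.
by apply: ler_sum => i _; have /brickP/(_ j)/andP[] := ab i.
Qed.

(** A vector [v] is the average of two vectors that share its last coordinates and
    carry twice its first, respectively second, block of [d] coordinates. *)
Lemma brick_sub_minkowski_average2 :
  brick 2 1 1 `<=` minkowski_average crossed_cubes 2.
Proof.
move=> v /brickP hv.
pose c (b : bool) : 'rV[R]_n := \row_j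
  (if (j < d)%N then b%:R * 2 * v ord0 j
   else if (j < d + d)%N then (~~ b)%:R * 2 * v ord0 j else v ord0 j).
have cb (b : bool) : brick 1 b (~~ b) (c b).
  apply/brickP => j; move: (hv j); rewrite /side !mxE.
  by case: ifP => _; [|case: ifP => _]; case: b => /=; lra.
exists (fun i : 'I_2 => c (i == ord0)).
  by move=> i; case: (i == ord0); [right|left]; exact: cb.
apply/rowP => j; rewrite !mxE summxE big_ord_recr big_ord1/= !mxE/=.
by case: ifP => _; [|case: ifP => _]; lra.
Qed.

End crossed_cubes.

Lemma Vol_crossed_cubes_lt (R : realType) (n : nat) : (12 <= n)%N ->
  (Vol (minkowski_average (@crossed_cubes R 6 n) 3) <
   Vol (minkowski_average (@crossed_cubes R 6 n) 2))%E.
Proof.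
move=> n12.
have mA k : measurable (coordinates (minkowski_average (@crossed_cubes R 6 n) k)).
  apply: compact_measurable_coordinates; apply: compact_minkowski_average.
  exact: compact_crossed_cubes.
have mB k p q : measurable (coordinates (@brick R 6 n k p q)).
  by apply: compact_measurable_coordinates; exact: compact_brick.
apply: (@lt_le_trans _ _ (Vol (@brick R 6 n 2 1 1))); last first.
  by apply: Vol_le => //; exact: brick_sub_minkowski_average2.
apply: (@le_lt_trans _ _ (\sum_(p < 4) Vol (@brick R 6 n 3 p (3 - p)))%E).
  apply: (@content_subadditive _ _ _ (lebesgue_tuple R n) _
    (fun p => coordinates (@brick R 6 n 3 p (3 - p))) 4%N).
  - by move=> p _; exact: mB.
  - exact: mA.
  move=> t /minkowski_average_crossed_cubes_sub[//|p h].
  by rewrite (bigD1 p)//=; left.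
rewrite !big_ord_recr big_ord0/= !Vol_brick// -!EFinD lte_fin.
rewrite !subSS !subn0; lra.
Qed.

(** * Averages of subsets of the line *)

Section line.
Variable R : realType.
Local Notation RT := (measurableTypeR R).
Local Notation mu := (@lebesgue_measure R).

Lemma measurable_affine (c b : R) :
  measurable_fun [set: RT] (fun x : RT => c * x + b : RT).
Proof.
apply: continuous_measurable_fun => x.
by apply: cvgD; [apply: cvgMl_tmp; exact: cvg_id|exact: cvg_cst].
Qed.

(** Both sides are measures in [X] that agree on half-open intervals. *)
Lemma lebesgue_measure_affine (c b : R) (X : set RT) : 0 < c -> measurable X ->
  mu X = (c%:E * mu ((fun x : RT => (c * x + b)%R : RT) @^-1` X))%E.
Proof.
move=> c0 mX.
pose f : {mfun RT >-> RT} := mfun_Sub (mem_set (measurable_affine c b)).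
pose c' : {nonneg R} := NngNum (ltW c0).
apply: (@lebesgue_measure_unique R (mscale c' (pushforward mu f))) mX.
move=> _ [[u v] _ <-].
rewrite [RHS](_ : _ = (c%:E * mu (f @^-1` `]u, v]))%E)//.
rewrite (_ : f @^-1` _ = `](u - b) / c, (v - b) / c]%classic).
  rewrite !lebesgue_measure_itv/= !lte_fin ltr_pM2r ?invr_gt0// ltrD2r.
  case: ifP => _; last by rewrite mule0.
  by rewrite -!EFinB -EFinM; congr EFin; field; rewrite gt_eqF.
apply/seteqP; split => x /=; rewrite !in_itv/= ltr_pdivrMr// ler_pdivlMr//.
  by rewrite ltrBlDr lerBrDr mulrC.
by rewrite ltrBlDr lerBrDr mulrC.
Qed.

Lemma le_lebesgue_measure_affine (c b : R) (X Y : set RT) :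
  0 < c -> measurable X -> measurable Y ->
  (forall x, X x -> Y (c * x + b)) -> (c%:E * mu X <= mu Y)%E.
Proof.
move=> c0 mX mY XY; rewrite (lebesgue_measure_affine b c0 mY).
have mf : measurable ((fun x : RT => (c * x + b)%R : RT) @^-1` Y).
  by rewrite -[X in measurable X]setTI; exact: measurable_affine.
apply: lee_wpmul2l; first by rewrite lee_fin ltW.
by apply: le_measure; rewrite ?inE.
Qed.

(** The heart of the one-dimensional case: [T] is covered by two parts that overlap
    in a [k]-th of [[m, M]], whose contracted copies in [S] do not overlap; the
    choice of the part is averaged out. *)
Lemma average_step_lebesgue_measure (T S : set RT) (k : nat) (m M : R) :
  (0 < k)%N -> measurable T -> measurable S ->
  (mu T < +oo)%E -> (mu S < +oo)%E ->
  (forall x, T x -> m <= x <= M) ->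
  (forall x, T x -> S ((k%:R * x + m) / k.+1%:R)) ->
  (forall x, T x -> S ((k%:R * x + M) / k.+1%:R)) ->
  (mu T <= mu S)%E.
Proof.
move=> k0 mT mS Tfin Sfin TmM TS_l TS_r.
have kR : k%:R > 0 :> R by rewrite ltr0n.
pose K : R := k.+1%:R.
have KE : K = k%:R + 1 by rewrite /K -natr1.
have K0 : K > 0 by rewrite ltr0n.
pose c : R := k%:R / K; have c0 : 0 < c by rewrite divr_gt0.
pose t i : R := m + i%:R * (M - m) / k%:R.
pose s i : R := m + i%:R * (M - m) / K.
pose L (x : R) : set RT := `]-oo, x]%classic.
have mL x : measurable (L x) by exact: measurable_itv.
have mTL x : measurable (T `&` L x) by exact: measurableI.
have mTR x : measurable (T `\` L x) by exact: measurableD.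
have mSL x : measurable (S `&` L x) by exact: measurableI.
have mSR x : measurable (S `\` L x) by exact: measurableD.
have fin X Y : measurable X -> measurable Y -> (mu Y < +oo)%E -> X `<=` Y ->
    mu X \is a fin_num.
  move=> mX mY Yoo XY; rewrite ge0_fin_numE//; apply: le_lt_trans Yoo.
  by apply: le_measure; rewrite ?inE.
(* [h] is the distribution function of [T] at the cutting points. *)
pose h i := fine (mu (T `&` L (t i))).
have step i : c * (h i.+1 - h i + fine (mu T)) <= fine (mu S).
  have left : (c%:E * mu (T `&` L (t i.+1)) <= mu (S `&` L (s i.+1)))%E.
    apply: (@le_lebesgue_measure_affine _ (m / K)) => // x [Tx].
    rewrite /L/= !in_itv/= => xt; split.
      by have := TS_l x Tx; rewrite /c mulrDl mulrAC.
    have : c * x + m / K <= c * t i.+1 + m / K by rewrite lerD2r ler_pM2l.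
    move=> /le_trans; apply; rewrite le_eqVlt; apply/orP; left; apply/eqP.
    rewrite /c /t /s KE; field.
    by rewrite -KE !gt_eqF.
  have right : (c%:E * mu (T `\` L (t i)) <= mu (S `\` L (s i.+1)))%E.
    apply: (@le_lebesgue_measure_affine _ (M / K)) => // x [Tx].
    rewrite /L/= !in_itv/= => /negP; rewrite -ltNge => xt; split.
      by have := TS_r x Tx; rewrite /c mulrDl mulrAC.
    apply/negP; rewrite -ltNge.
    have : c * t i + M / K < c * x + M / K by rewrite ltrD2r ltr_pM2l.
    apply: le_lt_trans; rewrite le_eqVlt; apply/orP; left; apply/eqP.
    rewrite /c /t /s KE -natr1; field.
    by rewrite -KE !gt_eqF.
  have TE := measureDI mu mT (mL (t i)).
  have SE := measureDI mu mS (mL (s i.+1)).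
  have f1 := fin _ _ (mTL (t i)) mT Tfin (@subIsetl _ _ _).
  have f2 := fin _ _ (mTL (t i.+1)) mT Tfin (@subIsetl _ _ _).
  have f3 := fin _ _ (mTR (t i)) mT Tfin (@subDsetl _ _ _).
  have f4 := fin _ _ (mSL (s i.+1)) mS Sfin (@subIsetl _ _ _).
  have f5 := fin _ _ (mSR (s i.+1)) mS Sfin (@subDsetl _ _ _).
  rewrite TE SE !fineD// /h.
  move: left right; rewrite -(fineK f2) -(fineK f3) -(fineK f4) -(fineK f5).
  rewrite -!EFinM !lee_fin !mulrDr mulrN; lra.
have tel : c * (h k - h 0 + k%:R * fine (mu T)) <= k%:R * fine (mu S).
  have := @ler_sum _ _ (index_iota 0 k) xpredT _ _ (fun i _ => step i).
  rewrite -mulr_sumr big_split/= telescope_sumr// !sumr_const_nat subn0.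
  by rewrite -[fine (mu T) *+ k]mulr_natl -[fine (mu S) *+ k]mulr_natl.
have hk : h k = fine (mu T).
  rewrite /h (_ : _ `&` _ = T)//; apply/setIidPl => x /TmM/andP[_ xM].
  by rewrite /L/= in_itv/= /t mulrC mulKf ?gt_eqF// subrKC.
(* [T] lies right of [m], so that its part left of [t 0] is at most [m] itself. *)
have h0 : h 0%N = 0.
  rewrite /h (_ : mu _ = 0%E)//; apply/eqP; rewrite -measure_le0.
  rewrite -(lebesgue_measure_set1 m); apply: le_measure; rewrite ?inE//.
  move=> x [/TmM/andP[mx _]]; rewrite /L/= in_itv/= /t mul0r mul0r addr0 => xm.
  by apply/eqP; rewrite eq_le mx xm.
move: tel; rewrite hk h0 subr0 -[X in X + _]mul1r -mulrDl addrC natr1.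
rewrite /c mulrA divfK ?gt_eqF// ler_pM2l// => TS.
rewrite -(fineK (fin _ _ mT mT Tfin (@subset_refl _ _))).
by rewrite -(fineK (fin _ _ mS mS Sfin (@subset_refl _ _))) lee_fin.
Qed.

Definition points (A : set 'rV[R]_1) : set R := [set v ord0 ord0 | v in A].

Lemma compact_points A : compact A -> compact (points A).
Proof.
by apply: continuous_compact; apply: continuous_subspaceT; exact: coord_continuous.
Qed.

Lemma Vol_points A : compact A -> Vol A = mu (points A).
Proof.
move=> cA.
have mX : measurable (points A : set RT).
  by apply: compact_measurable; exact: compact_points.
rewrite -[RHS]mule1 -(diracT R ([tuple] : 0.-tuple RT)).
rewrite -(product_measure1E mu (lebesgue_tuple R 0))//.
congr (product_measure1 _ _ _); apply/seteqP; split => -[x t] /=.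
  by move=> Ax; split=> //; exists (\row_i tnth (tuple_cons (x, t)) i); rewrite ?mxE.
move=> [[v Av vx] _]; rewrite (_ : \row_i _ = v)//.
by apply/rowP => i; rewrite mxE (ord1 i) -vx.
Qed.

Lemma Vol_minkowski_average_leS (A : set 'rV[R]_1) k : compact A ->
  (Vol (minkowski_average A k.+1) <= Vol (minkowski_average A k.+2))%E.
Proof.
move=> cA; have cAk p : compact (minkowski_average A p).
  exact: compact_minkowski_average.
have [->|A0] := eqVneq A set0.
  rewrite (_ : minkowski_average set0 k.+1 = set0) ?measure_ge0//.
    by rewrite (_ : Vol (set0 : set 'rV[R]_1) = 0%E)//; exact: measure0.
  by rewrite -subset0 => x [a /(_ ord0)].
have X0 : points A !=set0.
  by have /set0P[v Av] := A0; exists (v ord0 ord0), v.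
have id_cont : {within points A, continuous (id : R -> R)}.
  by apply: continuous_subspaceT => x; exact: cvg_id.
have [M /set_mem[vM AM <-] XM] := compact_EVT_max X0 (compact_points cA) id_cont.
have [m /set_mem[vm Am <-] Xm] := compact_EVT_min X0 (compact_points cA) id_cont.
rewrite !Vol_points//.
have mX p : measurable (points (minkowski_average A p) : set RT).
  by apply: compact_measurable; exact: compact_points.
have fX p : (mu (points (minkowski_average A p)) < +oo)%E.
  rewrite -Vol_points// -ge0_fin_numE; first exact: Vol_compact_fin_num.
  exact: measure_ge0.
have extend v x : A v -> points (minkowski_average A k.+1) x ->
    points (minkowski_average A k.+2) ((k.+1%:R * x + v ord0 ord0) / k.+2%:R).
  move=> Av [_ [a Aa <-] <-].
  exists (k.+2%:R^-1 *: (\sum_(i < k.+1) a i + v)); last first.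
    by rewrite !mxE mulrA mulfV// mul1r mulrC.
  exists (fun i : 'I_k.+2 => if unlift ord_max i is Some j then a j else v).
    by move=> i /=; case: unlift.
  congr (_ *: _); rewrite big_ord_recr/= unlift_none; congr (_ + _).
  apply: eq_bigr => i _.
  by rewrite (_ : widen_ord _ i = lift ord_max i) ?liftK//; apply/val_inj;
     rewrite /= /bump leqNgt ltn_ord.
apply: (@average_step_lebesgue_measure _ _ k.+1 (vm ord0 ord0) (vM ord0 ord0)) => //.
- move=> _ [_ [a Aa <-] <-]; rewrite !mxE summxE.
  have aX i : a i ord0 ord0 \in points A by rewrite inE; exists (a i).
  rewrite ler_pdivlMl// ler_pdivrMl//.
  rewrite -[X in X%:R * _]card_ord -[X in _ && (_ <= X%:R * _)]card_ord.
  rewrite !mulr_natl -!sumr_const; apply/andP; split; apply: ler_sum => i _.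
    exact: Xm.
  exact: XM.
- by move=> x; exact: extend.
- by move=> x; exact: extend.
Qed.

End line.

(** * The theorem *)

Theorem theorem1p1 (R : realType) :
  [/\ forall (n : nat) (A : set 'rV[R]_n), (0 < n)%N -> compact A ->
        nonincreasing_seq
          (fun k => volume_deficit (minkowski_average A k.+1)) <->
        nondecreasing_seq (fun k => Vol (minkowski_average A k.+1)),
      forall n : nat, (12 <= n)%N ->
        ~ deficit_monotone R n /\
        exists (A : set 'rV[R]_n) (k : nat),
          [/\ compact A, (1 <= k)%N &
              (Vol (minkowski_average A k.+1) <
               Vol (minkowski_average A k))%E]
    & deficit_monotone R 1].
Proof.
split=> [n A _ cA|n n12|A cA]; first exact: nonincreasing_deficit_Vol.
  have cC := @compact_crossed_cubes R 6 n.
  have lt32 := Vol_crossed_cubes_lt R n12.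
  split; last by exists (@crossed_cubes R 6 n), 2%N.
  move=> /(_ _ cC) /(nonincreasing_deficit_Vol cC) /(_ 1%N 2%N isT).
  by rewrite leNgt lt32.
apply/(nonincreasing_deficit_Vol cA)/nondecreasing_seqP => k.
exact: Vol_minkowski_average_leS.
Qed.
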